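(* Suppose that $\{\gamma_n\}_{n=0}^{\infty}$ is a sequence of real numbers such that $\limsup_{n\to\infty}|\gamma_n|^{1/n}<\infty$. Then the following conditions are equivalent: (i) the sequence $\{\gamma_n\}_{n=0}^{\infty}$ is PD; (ii) the sequence $\{\theta^n\gamma_n\}_{n=0}^{\infty}$ is CPD for all $\theta\in\mathbb{R}$; (iii) zero is an accumulation point of the set of all $\theta\in\mathbb{R}\setminus\{0\}$ for which the sequence $\{\theta^n\gamma_n\}_{n=0}^{\infty}$ is CPD; (iv) there exists $\theta\in\mathbb{R}\setminus\{0\}$ such that $|\theta|\cdot\limsup_{n\to\infty}|\gamma_n|^{1/n}<1$ and the sequence $\{\theta^n\gamma_n\}_{n=0}^{\infty}$ is CPD.
   Context: A real sequence $\{\gamma_n\}_{n=0}^\infty$ is positive definite (PD) if $\sum_{i,j=0}^k \gamma_{i+j}\lambda_i\bar\lambda_j\geq 0$ for all finite complex sequences $\lambda_0,\ldots,\lambda_k$; it is conditionally positive definite (CPD) if the same inequality holds for all finite complex sequences $\lambda_0,\ldots,\lambda_k$ with $\sum_{i=0}^k\lambda_i=0$. *)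

(* Defs.v *)
From mathcomp Require Import all_boot all_order all_algebra.
From mathcomp Require Import all_classical all_reals all_analysis.
From mathcomp Require Import complex.

Set Implicit Arguments.
Unset Strict Implicit.
Unset Printing Implicit Defensive.

Import Order.TTheory GRing.Theory Num.Theory.
Import numFieldNormedType.Exports.

Local Open Scope classical_set_scope.
Local Open Scope ring_scope.
Local Open Scope complex_scope.

(* The order on R[i] is partial: 0 <= z means that z is a nonnegative real. *)
Definition hankel_form (R : realType) (gamma : nat -> R) (k : nat)
    (lambda : 'I_k.+1 -> R[i]) : R[i] :=
  \sum_(i < k.+1) \sum_(j < k.+1)
    (gamma (i + j)%N)%:C * lambda i * (lambda j)^*.

Definition PD (R : realType) (gamma : nat -> R) : Prop :=
  forall (k : nat) (lambda : 'I_k.+1 -> R[i]), 0 <= hankel_form gamma lambda.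

Definition CPD (R : realType) (gamma : nat -> R) : Prop :=
  forall (k : nat) (lambda : 'I_k.+1 -> R[i]),
    \sum_(i < k.+1) lambda i = 0 -> 0 <= hankel_form gamma lambda.

(* The term n = 0, where 0^-1 = 0, does not affect the limit superior. *)
Definition root_limsup (R : realType) (gamma : nat -> R) : \bar R :=
  limn_esup (fun n : nat => (`|gamma n| `^ (n%:R^-1))%:E).

(* Main.v *)
(* For (iv) => (i), the sequence a_n = theta^n gamma_n tends to 0 and is CPD.
   Given lambda_0, ..., lambda_k with sum s, put the extra coefficient -s at a
   far away index M, which makes the coefficients sum to 0. The added terms of
   the form involve only the a_n with n >= M, so they vanish as M tends to
   infinity and the form at lambda is nonnegative. Rescaling lambda_i by
   theta^(-i) passes from a to gamma. *)
Require Import Defs.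
From mathcomp Require Import all_boot all_order all_algebra.
From mathcomp Require Import all_classical all_reals all_analysis.
From mathcomp Require Import complex ring lra zify.

Import Order.TTheory GRing.Theory Num.Theory.
Import numFieldNormedType.Exports.

Local Open Scope classical_set_scope.
Local Open Scope ring_scope.

Lemma conjc_realM {R : realType} (x : R) (z : R[i]) :
  Num.conj (real_complex R x * z) = real_complex R x * Num.conj z.
Proof. by rewrite rmorphM; congr (_ * _); exact: conjc_real. Qed.

(** As [theta ^+ (i + j)] splits into a factor for [i] and one for [j], and the latter is real and
    so fixed by conjugation, both are absorbed into the coefficients. *)
Lemma hankel_form_geometric {R : realType} (gamma : nat -> R) (theta : R)
    (k : nat) (lambda : 'I_k.+1 -> R[i]) :
  hankel_form (fun n => theta ^+ n * gamma n) lambda =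
  hankel_form gamma (fun i => real_complex R (theta ^+ i) * lambda i).
Proof.
apply: eq_bigr => i _; apply: eq_bigr => j _ /=.
rewrite conjc_realM exprD !rmorphM /=; ring.
Qed.

Lemma PD_geometric {R : realType} (gamma : nat -> R) (theta : R) :
  PD gamma -> PD (fun n => theta ^+ n * gamma n).
Proof. by move=> pd k lambda; rewrite hankel_form_geometric. Qed.

Lemma PD_CPD {R : realType} (gamma : nat -> R) : PD gamma -> CPD gamma.
Proof. by move=> pd k lambda _. Qed.

(** The filler [z] occupies a gap of length [N] and contributes nothing. Letting [F] see both index
    and coefficient makes this usable for the plain sum of the coefficients and for the inner and
    outer sums of the form. *)
Lemma sum_append {V : nmodType} {C : Type} (z t : C) {k : nat} (N : nat)
    (lambda : 'I_k.+1 -> C) (F : nat -> C -> V) :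
  (forall i, F i z = 0) ->
  \sum_(i < (k.+1 + N).+1)
     F i (if i == (k.+1 + N)%N :> nat then t
          else if (i < k.+1)%N then lambda (inord i) else z) =
  \sum_(i < k.+1) F i (lambda i) + F (k.+1 + N)%N t.
Proof.
move=> Fz; rewrite big_ord_recr /= eqxx; congr (_ + _).
rewrite big_split_ord /= [X in _ + X]big1 ?addr0 => [|i _]; last first.
  by rewrite eqn_add2l ltn_eqF //= ltnNge leq_addr.
apply: eq_bigr => i _.
by rewrite ltn_eqF ?ltn_ord ?inord_val // ltn_addr.
Qed.

(** Convergence to 0 in [R[i]], taken coordinatewise so that limits of real sequences suffice. *)
Definition vanishes {R : realType} (u : nat -> R[i]) : Prop :=
  complex.Re (u n) @[n --> \oo] --> (0 : R) /\
  complex.Im (u n) @[n --> \oo] --> (0 : R).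

Lemma vanishesD {R : realType} (u v : nat -> R[i]) :
  vanishes u -> vanishes v -> vanishes (fun n => u n + v n).
Proof.
move=> [ur ui] [vr vi]; split.
  under eq_fun do rewrite (raddfD (@complex.Re R : Rcomplex R -> R)).
  by rewrite -[0]addr0; apply: cvgD.
under eq_fun do rewrite (raddfD (@complex.Im R : Rcomplex R -> R)).
by rewrite -[0]addr0; apply: cvgD.
Qed.

Lemma vanishes_sum {R : realType} {I : Type} (r : seq I)
    (u : I -> nat -> R[i]) :
  (forall i, vanishes (u i)) -> vanishes (fun n => \sum_(i <- r) u i n).
Proof.
move=> uv; elim: r => [|i r IH].
  by split; under eq_fun do rewrite big_nil; apply: cvg_cst.
by under eq_fun do rewrite big_cons; apply: vanishesD.
Qed.

Lemma vanishes_realM {R : realType} (a : nat -> R) (c : R[i]) :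
  a @ \oo --> (0 : R) -> vanishes (fun n => real_complex R (a n) * c).
Proof.
move=> a0; case: c => x y; split => /=.
  under eq_fun do rewrite mul0r subr0.
  by rewrite -(mul0r x); apply: cvgMr_tmp.
under eq_fun do rewrite mul0r addr0.
by rewrite -(mul0r y); apply: cvgMr_tmp.
Qed.

(** In the partial order on [R[i]], the hypothesis makes the imaginary part of [u n] constantly that
    of [- z], so its limit 0 forces [z] to be real; the real parts give an inequality that survives
    the limit. *)
Lemma vanishes_ge0 {R : realType} {z : R[i]} (u : nat -> R[i]) :
  vanishes u -> (forall n, 0 <= z + u n) -> 0 <= z.
Proof.
move=> [ur ui] zu; rewrite lecE.
have uz n : complex.Im (u n) = - complex.Im z /\ - complex.Re z <= complex.Re (u n).
  have := zu n; rewrite lecE; case: (z) (u n) => a b [c d] /= /andP[/eqP bd ac].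
  by split; lra.
have imz : complex.Im (u n) @[n --> \oo] --> - complex.Im z.
  by under eq_fun do rewrite (uz _).1; apply: cvg_cst.
have rez : - complex.Re z <= 0.
  rewrite -(cvg_lim _ ur) //; apply: limr_ge; first exact: cvgP ur.
  by apply: nearW => n; exact: (uz n).2.
have im0 : - complex.Im z = 0 by exact: cvg_unique imz ui.
by rewrite /= -oppr_le0 rez andbT -[complex.Im z]opprK im0 oppr0.
Qed.

Lemma CPD_cvg0_PD {R : realType} {a : nat -> R} :
  a @ \oo --> (0 : R) -> CPD a -> PD a.
Proof.
move=> a0 cpd k lambda.
pose s := \sum_(i < k.+1) lambda i.
pose M N := (k.+1 + N)%N.
(* The added terms are the column, the row and the corner at index [M N]. *)
apply: (vanishes_ge0 (fun N =>
  \sum_(i < k.+1) real_complex R (a (i + M N)%N) * (lambda i * Num.conj (- s)) +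
  (\sum_(j < k.+1) real_complex R (a (M N + j)%N) * (- s * Num.conj (lambda j)) +
  real_complex R (a (M N + M N)%N) * (- s * Num.conj (- s))))).
  have sub (f : nat -> nat) : (forall n, (n <= f n)%N) ->
      (fun n => a (f n)) @ \oo --> (0 : R).
    move=> nf; apply: cvg_comp a0 => V [m _ mV].
    by exists m => // n /= mn; apply: mV => /=; exact: leq_trans mn (nf n).
  apply: vanishesD; last apply: vanishesD.
  - apply: vanishes_sum => i; apply: vanishes_realM; apply: sub => n;
    rewrite /M; lia.
  - apply: vanishes_sum => i; apply: vanishes_realM; apply: sub => n;
    rewrite /M; lia.
  - apply: vanishes_realM; apply: sub => n;
    rewrite /M; lia.
move=> N.
have := cpd (M N) (fun i => if i == M N :> nat then - s else
  if (i < k.+1)%N then lambda (inord i) else 0).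
rewrite (sum_append _ _ _ _ (fun _ x => x)) // subrr => /(_ erefl).
rewrite /hankel_form.
(* The extra index is split off first in the inner sum over [j], then in the outer sum over [i]. *)
under eq_bigr => i _.
  rewrite (sum_append _ _ _ _
    (fun j x => real_complex R (a (i + j)%N) * _ * Num.conj x)); last first.
    by move=> ?; rewrite rmorph0 mulr0.
  over.
rewrite (sum_append _ _ _ _ (fun i x =>
  \sum_(j < k.+1) real_complex R (a (i + j)%N) * x * Num.conj (lambda j) +
  real_complex R (a (i + (k.+1 + N))%N) * x * Num.conj (- s))).
  rewrite big_split /= addrA.
  congr (0 <= _); rewrite -!addrA; congr (_ + (_ + (_ + _))); rewrite /M ?mulrA //;
  by apply: eq_bigr => *; rewrite mulrA.
by move=> i; rewrite mulr0 mul0r addr0 big1 // => j _; rewrite mulr0 mul0r.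
Qed.

(** The limit superior is an infimum of suprema over neighbourhoods of infinity, so one of these
    suprema is already below [x]. *)
Lemma limn_esup_lt {R : realType} {u : nat -> \bar R} {x : \bar R} :
  (limn_esup u < x)%E -> \forall n \near \oo, (u n < x)%E.
Proof.
move=> /ereal_inf_lt [_ [V nV <-]] lt.
apply: filterS nV => n Vn; apply: le_lt_trans lt.
by apply: ereal_sup_ubound; exists n.
Qed.

Lemma lt_root_expr {R : realType} {x r : R} {n : nat} :
  (0 < n)%N -> 0 <= x -> x `^ (n%:R^-1) < r -> x <= r ^+ n.
Proof.
move=> n0 x0 xr.
have -> : x = (x `^ (n%:R^-1)) ^+ n.
  by rewrite -powR_mulrn ?powR_ge0 // -powRrM mulVf ?powRr1 // pnatr_eq0 -lt0n.
apply: lerXn2r (ltW xr); rewrite nnegrE ?powR_ge0 //.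
exact: le_trans (powR_ge0 _ _) (ltW xr).
Qed.

(** Root test: for [r] between the limit superior and [1/|theta|], the terms are eventually
    dominated by the geometric sequence of ratio [|theta| * r < 1]. *)
Lemma geometric_cvg0 {R : realType} {gamma : nat -> R} {theta : R} :
  theta != 0 -> (`|theta|%:E * root_limsup gamma < 1)%E ->
  (fun n => theta ^+ n * gamma n) @ \oo --> (0 : R).
Proof.
move=> t0; have tp : 0 < `|theta| by rewrite normr_gt0.
rewrite -lte_pdivlMl // mule1 => lim.
have [r [r0 lr tr]] : exists r : R,
    [/\ 0 <= r, (root_limsup gamma < r%:E)%E & `|theta| * r < 1].
  move: lim; case: root_limsup => [l| |] // lim.
    (* The midpoint lies strictly between [l] and [1/|theta|]; the maximum with 0 ensures [0 <= r]
       whatever the sign of [l]. *)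
    rewrite lte_fin in lim; exists (Num.max 0 ((l + `|theta|^-1) / 2)).
    have ti : 0 < `|theta|^-1 by rewrite invr_gt0.
    rewrite le_max lexx lte_fin lt_max -ltr_pdivlMl // mulr1 gt_max ti.
    by split => //=; [apply/orP; right|]; lra.
  by exists 0; rewrite lexx ltNyr mulr0 ltr01.
have tr0 : 0 <= `|theta| * r by rewrite mulr_ge0.
have r_lt1 : `| `|theta| * r | < 1 by rewrite ger0_norm.
apply/norm_cvg0P; apply: (squeeze_cvgr _ (cvg_cst 0) (cvg_expr r_lt1)).
near=> n; rewrite normr_ge0 normrM normrX exprMn ler_wpM2l ?exprn_ge0 //=.
apply: lt_root_expr => //; first by near: n; exact: nbhs_infty_gt.
rewrite -lte_fin; near: n; exact: limn_esup_lt lr.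
Unshelve. all: by end_near. Qed.

Theorem theorem2p2p13 (R : realType) (gamma : nat -> R)
    (hgamma : (root_limsup gamma < +oo)%E) :
  [<-> PD gamma;
       forall theta : R, CPD (fun n => theta ^+ n * gamma n);
       limit_point
         [set theta : R | theta != 0 /\ CPD (fun n => theta ^+ n * gamma n)] 0;
       exists theta : R,
         [/\ theta != 0,
             (`|theta|%:E * root_limsup gamma < 1)%E
           & CPD (fun n => theta ^+ n * gamma n)] ].
Proof.
tfae.
- by move=> pd theta; apply/PD_CPD/PD_geometric.
- move=> cpd U; rewrite -nbhs_ballE => -[e /= e0 eU].
  have e2 : 0 < e / 2 by rewrite divr_gt0.
  exists (e / 2); split; first by rewrite gt_eqF.
    by split => //; rewrite gt_eqF.
  by apply: eU; rewrite /ball /= sub0r normrN gtr0_norm //; lra.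
- move=> lp.
  (* Finiteness of the limit superior makes every small enough [t] satisfy the bound in (iv);
     accumulation at 0 then supplies such a [t]. *)
  have [e e0 he] : exists2 e : R, 0 < e & forall t : R, t != 0 -> `|t| < e ->
      (`|t|%:E * root_limsup gamma < 1)%E.
    move: hgamma; case: root_limsup => [l| |] // _.
      (* The added 1 keeps the radius meaningful when [l] is 0. *)
      exists (`|l| + 1)^-1; first by rewrite invr_gt0 ltr_wpDl.
      move=> t _; rewrite -EFinM lte_fin -[ltRHS]mul1r ltr_pdivlMr ?ltr_wpDl // => tl.
      by have := ler_wpM2l (normr_ge0 t) (ler_norm l); have := normr_ge0 t; lra.
    exists 1 => // t tn0 _; rewrite gt0_muleNy ?ltNyr // lte_fin normr_gt0 //.
  have [t [t0 [_ tcpd] te]] := lp _ (nbhsx_ballx (0 : R) e e0).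
  exists t; split => //; apply: he => //.
  by move: te; rewrite /ball /= sub0r normrN.
- move=> [theta [t0 lim cpd]].
  have pd := CPD_cvg0_PD (geometric_cvg0 t0 lim) cpd.
  have -> : gamma = fun n => theta^-1 ^+ n * (theta ^+ n * gamma n).
    apply/funext => n; rewrite mulrA -exprMn mulVf // expr1n mul1r //.
  exact: PD_geometric.
Qed.
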